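(* Let $H^\times$ be a finite abelian group written multiplicatively, with a distinguished element $-1$ of order $1$ or $2$. Let $\pi$ be a binary relation on $H^\times$ which is a union of blocks, and let $H_\pi$ be the associated structure on $H^\times \cup \{0\}$. Let $m$ be the largest number such that $|(w+1)-\{0\}| \geq m$ for all $w \in H^\times$, and let $k$ be the largest number such that $|\{u \in H^\times : w \in u+1\}| \geq k$ for all $w \in H^\times$, where $+$ is the addition of $H_\pi$. If $m+k > |H^\times|$, then $H_\pi$ is a hyperfield.
   Context: **Hyperfield.** For a nonempty set $H$, let $\mathcal{P}^*(H)$ be the set of nonempty subsets of $H$. A hyperaddition is a map $+ : H\times H \to \mathcal{P}^*(H)$ with $a+b=b+a$ and $(a+b)+c=a+(b+c)$, where $A+x=\bigcup_{a\in A}(a+x)$ for $A\subseteq H$ (a one-element set is identified with its element). A hyperfield is a set $H$ with a hyperaddition and an ordinary commutative multiplication such that: (Zero) there is a unique $0\in H$ with $0+h=h$ for all $h$; (Negative) for each $x$ there is a unique $y=:-x$ with $0\in x+y$; (Reversibility) if $x\in y+z$ then $z\in x+(-y)$; $(H,\cdot)$ is a monoid; $a(b+c)=ab+ac$ for all $a,b,c$; $r\cdot 0=0$ for all $r$; and $H^\times=H-\{0\}$ is a group under multiplication. **The structure $H_\pi$.** Let $H^\times$ be an abelian group (multiplicative), with distinguished element $-1$ of order $1$ or $2$, and write $-x=(-1)x$. Given a binary relation $\pi$ on $H^\times$, the structure $H_\pi$ has universe $H^\times\cup\{0\}$ with $0$ a new element. Multiplication is that of $H^\times$ together with $0\cdot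 x=x\cdot 0=0$. Addition: $0+x=x+0=x$ for all $x$; for $x,y\in H^\times$, $x+y = y\cdot P(y^{-1}x)$, where $P(z)=\{w\in H^\times : z\mathrel{\pi} w\}$ for $z\neq -1$ and $P(-1)=\{w\in H^\times : -1\mathrel{\pi} w\}\cup\{0\}$. **Blocks.** A set $S\subseteq H^\times\times H^\times$ is closed under consistency if for all $x\in H^\times-\{1\}$ and $y\in H^\times$: $(x,y)\in S$ iff $(x^{-1},x^{-1}y)\in S$. It is closed under reversal/negation if for all $x,y\in H^\times$: $(x,y)\in S$ iff $(-y,-x)\in S$. The blocks (of $H^\times$ with $-1$) are the minimal nonempty subsets of $H^\times\times H^\times$ closed under both; they partition $H^\times\times H^\times$. *)

(* Defs.v *)
(* MathComp, not Stdlib.  Hyperoperations on an arbitrary type take values in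
   the [set] of [classical_sets]; $H_\pi$ itself is built with finite sets.
   [classical_sets] is imported first so that unqualified set notions such as
   [set0] are those of [finset]. *)
From mathcomp Require Import classical_sets.
From mathcomp Require Import all_boot all_fingroup.

Set Implicit Arguments.
Unset Strict Implicit.
Unset Printing Implicit Defensive.

(* [zero], [one] and [opp] are determined by [add] and [mul]; they are
   existentially quantified in [is_hyperfield]. *)
Record hyperfield_axioms (H : Type) (add : H -> H -> set H)
    (mul : H -> H -> H) (zero one : H) (opp : H -> H) : Prop := {
  hf_add_nonempty : forall a b, (add a b !=set0)%classic;
  hf_addC : forall a b, add a b = add b a;
  hf_addA : forall a b c,
    (\bigcup_(u in add a b) add u c = \bigcup_(v in add b c) add a v)%classic;
  hf_zero : unique (fun z => forall h, add z h = [set h]%classic) zero;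
  hf_opp : forall x, unique (fun y => add x y zero) (opp x);
  hf_reversible : forall x y z, add y z x -> add x (opp y) z;
  hf_mulC : forall a b, mul a b = mul b a;
  hf_mulA : forall a b c, mul a (mul b c) = mul (mul a b) c;
  hf_mul1 : forall a, mul one a = a;
  hf_distr : forall a b c,
    (mul a @` add b c = add (mul a b) (mul a c))%classic;
  hf_mul0 : forall r, mul r zero = zero;
  hf_one_neq0 : one <> zero;
  hf_mul_neq0 : forall a b, a <> zero -> b <> zero -> mul a b <> zero;
  hf_inv : forall a, a <> zero -> exists2 b, b <> zero & mul a b = one
}.

Definition is_hyperfield (H : Type) (add : H -> H -> set H)
    (mul : H -> H -> H) : Prop :=
  exists zero one opp, hyperfield_axioms add mul zero one opp.

Section Hpi.
Variables (gT : finGroupType) (e : gT).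
Local Open Scope group_scope.

(* The element [e] stands for $-1$, so $-x$ is [e * x]. *)

Definition consistency_closed (S : {set gT * gT}) : bool :=
  [forall x, forall y,
     (x != 1) ==> (((x, y) \in S) == ((x^-1, x^-1 * y) \in S))].

Definition reversal_closed (S : {set gT * gT}) : bool :=
  [forall x, forall y, ((x, y) \in S) == ((e * y, e * x) \in S)].

Definition block (S : {set gT * gT}) : bool :=
  minset (fun S' : {set gT * gT} =>
    [&& S' != set0, consistency_closed S' & reversal_closed S']) S.

Definition union_of_blocks (pi : {set gT * gT}) : Prop :=
  exists2 B : {set {set gT * gT}}, {in B, forall S, block S} & pi = cover B.

(* The universe of $H_\pi$ is [option gT], with [None] as its zero. *)

Definition Hpi_mul (x y : option gT) : option gT :=
  if (x, y) is (Some a, Some b) then Some (a * b) else None.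

Definition Hpi_P (pi : {set gT * gT}) (z : gT) : {set option gT} :=
  let A := [set Some w | w in [set w | (z, w) \in pi]] in
  if z == e then None |: A else A.

Definition Hpi_add (pi : {set gT * gT}) (x y : option gT) : {set option gT} :=
  match x, y with
  | None, _ => [set y]
  | _, None => [set x]
  | Some a, Some b => [set Hpi_mul (Some b) w | w in Hpi_P pi (b^-1 * a)]
  end.

End Hpi.

Definition largest (Q : nat -> Prop) (n : nat) : Prop :=
  Q n /\ forall n', Q n' -> n' <= n.

(* Main.v *)
Require Import Defs.
From mathcomp Require Import classical_sets.
From mathcomp Require Import all_boot all_fingroup.

(** Closure of [pi] under consistency is commutativity of the addition, and
    closure under reversal is reversibility; distributivity holds because
    membership of [w] in [a + b] only depends on the quotients of [a], [b] and
    [w].  What a union of blocks can fail is associativity (and nonemptiness of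
    the sums), and this is where counting enters.  For nonzero [a], [b], [c]
    and [w], the nonzero [u] in [a + b] form a translate of
    [(b^-1 a + 1) - {0}], so there are at least [m] of them; the nonzero [u]
    with [w] in [u + c] form a translate of [{u | c^-1 w \in u + 1}], so there
    are at least [k] of them.
    If [m + k] exceeds the order of the group, these two sets meet, hence
    [w] lies in [(a + b) + c] (lemma [exists_intermediate_sum]).  Thus a triple
    sum of nonzero elements contains every nonzero element however it is
    bracketed, and only the membership of zero is left: it lies in
    [(a + b) + c] iff [-c] lies in [a + b], iff [-a] lies in [b + c], by
    reversibility alone. *)

Set Implicit Arguments.
Unset Strict Implicit.
Unset Printing Implicit Defensive.

(** * Membership in a sum *)

Section Membership.
Local Open Scope group_scope.
Variables (gT : finGroupType) (e : gT) (pi : {set gT * gT}).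
Local Notation add := (Hpi_add e pi).

Lemma mem_add_Some (a b w : gT) :
  (Some w \in add (Some a) (Some b)) = ((b^-1 * a, b^-1 * w) \in pi).
Proof.
have memP z v : (Some v \in Hpi_P e pi z) = ((z, v) \in pi).
  by rewrite /Hpi_P; case: ifP => _; rewrite ?inE /= mem_imset ?inE //;
     apply: Some_inj.
rewrite /= -memP; apply/imsetP/idP => [[[v|] // vP [->]]|wP].
  by rewrite mulKg.
by exists (Some (b^-1 * w)); rewrite // /Hpi_mul mulKVg.
Qed.

Lemma mem_add_None (a b : gT) :
  (None \in add (Some a) (Some b)) = (b^-1 * a == e).
Proof.
apply/imsetP/idP => [[[v|] // + _]|/eqP ab]; last first.
  by exists None => //; rewrite /Hpi_P ab eqxx !inE.
by rewrite /Hpi_P; case: ifP => // _ /imsetP[].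
Qed.

Lemma mem_add0x (y w : option gT) : (w \in add None y) = (w == y).
Proof. by rewrite /= inE. Qed.

Lemma mem_addx0 (x w : option gT) : (w \in add x None) = (w == x).
Proof. by case: x => [a|]; rewrite /= inE. Qed.

Lemma add_Some1_nonzero (w : gT) :
  #|add (Some w) (Some 1) :\ None| = #|[set v | (w, v) \in pi]|.
Proof.
rewrite -[RHS](card_imset _ (@Some_inj _)); apply: eq_card.
case=> [v|]; rewrite in_setD1.
  by rewrite mem_add_Some invg1 !mul1g mem_imset ?inE //; apply: Some_inj.
by symmetry; apply/negP => /imsetP[].
Qed.

Lemma add_Some1_summands (w : gT) :
  [set u | Some w \in add (Some u) (Some 1)] = [set u | (u, w) \in pi].
Proof. by apply/setP => u; rewrite !inE mem_add_Some invg1 !mul1g. Qed.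

End Membership.

Lemma card_translate (gT : finGroupType) (g : gT) (A : {set gT}) :
  #|[set u | (g * u)%g \in A]| = #|A|.
Proof.
rewrite -(card_imset A (mulgI g^-1%g)); apply: eq_card => u.
rewrite inE; apply/idP/imsetP => [guA|[v vA ->]].
  by exists (g * u)%g; rewrite ?mulKg.
by rewrite mulKVg.
Qed.

Lemma union_of_blocks_closed (gT : finGroupType) (e : gT)
    (pi : {set gT * gT}) :
  union_of_blocks e pi -> consistency_closed pi /\ reversal_closed e pi.
Proof.
case=> B blockB ->.
have closedB S : S \in B -> consistency_closed S /\ reversal_closed e S.
  by move/blockB/minsetp => /and3P[].
split; apply/forallP => x; apply/forallP => y.
  apply/implyP => x1; apply/eqP.
  apply/bigcupP/bigcupP => -[S SB xyS]; exists S => //.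
    have /forallP/(_ x)/forallP/(_ y) := (closedB S SB).1.
    by rewrite x1 xyS => /eqP <-.
  have /forallP/(_ x)/forallP/(_ y) := (closedB S SB).1.
  by rewrite x1 xyS => /eqP ->.
apply/eqP; apply/bigcupP/bigcupP => -[S SB xyS]; exists S => //.
  have /forallP/(_ x)/forallP/(_ y) := (closedB S SB).2.
  by rewrite xyS => /eqP <-.
have /forallP/(_ x)/forallP/(_ y) := (closedB S SB).2.
by rewrite xyS => /eqP ->.
Qed.

(** * Commutativity, reversibility and distributivity *)

Section ClosedRelation.
Local Open Scope group_scope.
Variables (gT : finGroupType) (e : gT) (pi : {set gT * gT}).
Hypotheses (abelG : abelian [set: gT]) (ee1 : e * e = 1).
Hypotheses (pi_cons : consistency_closed pi) (pi_rev : reversal_closed e pi).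
Local Notation add := (Hpi_add e pi).
Local Notation mul := (@Hpi_mul gT).

Definition Hpi_opp (x : option gT) : option gT := mul (Some e) x.

Let mulgC (a b : gT) : a * b = b * a.
Proof. by apply: (centsP abelG); rewrite inE. Qed.

Let invge : e^-1 = e.
Proof. by apply/eqP; rewrite eq_invg_mul ee1. Qed.

Lemma Hpi_oppK : involutive Hpi_opp.
Proof. by case=> [a|] //=; rewrite /Hpi_opp /Hpi_mul mulgA ee1 mul1g. Qed.

Lemma Hpi_mulC (x y : option gT) : mul x y = mul y x.
Proof. by case: x y => [a|] [b|] //; rewrite /Hpi_mul mulgC. Qed.

Lemma mem_add_eq0 (x y : option gT) : (None \in add x y) = (y == Hpi_opp x).
Proof.
case: x y => [a|] [b|]; rewrite ?mem_add0x ?mem_addx0 //.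
rewrite mem_add_None /Hpi_opp /= (inj_eq (@Some_inj _)).
apply/eqP/eqP => [ba|->].
  by rewrite -(mulKVg b a) ba (mulgC b) mulgA ee1 mul1g.
by rewrite invMg invge (mulgC a^-1) mulgKV.
Qed.

(** A relation [(b^-1 a, b^-1 w)] is moved to [(a^-1 b, a^-1 w)] by
    consistency; the excluded case [b^-1 a = 1] is [a = b]. *)
Lemma Hpi_addC (x y : option gT) : add x y = add y x.
Proof.
apply/setP; case: x y => [a|] [b|] w; rewrite ?mem_add0x ?mem_addx0 //.
case: w => [w|]; last first.
  by rewrite !mem_add_eq0 -(inj_eq (inv_inj Hpi_oppK)) Hpi_oppK eq_sym.
rewrite !mem_add_Some; have [-> //|neq_ab] := eqVneq a b.
have ba1 : b^-1 * a != 1 by rewrite -eq_mulVg1 eq_sym.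
have /forallP/(_ (b^-1 * a))/forallP/(_ (b^-1 * w)) := pi_cons.
by rewrite ba1 => /eqP ->; rewrite invMg invgK -mulgA mulKVg.
Qed.

Lemma Hpi_add_reversible (x y z : option gT) :
  x \in add y z -> z \in add x (Hpi_opp y).
Proof.
case: y => [b|]; last by rewrite mem_add0x mem_addx0 => /eqP->.
case: z => [c|]; last by rewrite mem_addx0 mem_add_eq0 => /eqP->.
case: x => [a|]; last by rewrite mem_add_eq0 mem_add0x.
rewrite Hpi_addC !mem_add_Some invMg invge.
have /forallP/(_ (b^-1 * c))/forallP/(_ (b^-1 * a))/eqP -> := pi_rev.
by rewrite !mulgA (mulgC e).
Qed.

(** Multiplication by [a != 0] is a bijection that preserves quotients.  For
    [x = 0] the left side is [{0}] only because [y + z] is nonempty. *)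
Lemma Hpi_distr (x y z : option gT) : (exists w, w \in add y z) ->
  [set mul x w | w in add y z] = add (mul x y) (mul x z).
Proof.
case: x => [a|] [w0 yz0]; last first.
  apply/setP => w; rewrite mem_add0x.
  by apply/imsetP/eqP => [[v _ ->]|->] //; exists w0.
have mulK g : cancel (mul (Some g)) (mul (Some g^-1)).
  by case=> [v|] //; rewrite /Hpi_mul mulKg.
have mulVK : cancel (mul (Some a^-1)) (mul (Some a)).
  by move=> v; rewrite -{1}(invgK a) mulK.
apply/setP => w; rewrite -[w]mulVK mem_imset; last exact: can_inj (mulK a).
move: (mul _ w) => {}w; symmetry.
have mul_inj := inj_eq (can_inj (mulK a)).
case: y z yz0 => [b|] [c|] _; rewrite ?(mem_add0x, mem_addx0) ?mul_inj //.
case: w => [w|].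
  by rewrite !mem_add_Some invMg -!mulgA !mulKg.
by rewrite !mem_add_None invMg -!mulgA !mulKg.
Qed.

(** * Associativity from the counting condition *)

Variables m k : nat.
Hypothesis m_le : forall z, m <= #|[set v | (z, v) \in pi]|.
Hypothesis k_le : forall v, k <= #|[set z | (z, v) \in pi]|.
Hypothesis m_k : #|gT| < m + k.

(** The [u] satisfying the first condition and those satisfying the second are
    at least [m] and at least [k] in number, too many to be disjoint. *)
Lemma exists_intermediate_sum (a b c w : gT) :
  exists2 u, Some u \in add (Some a) (Some b) & Some w \in add (Some u) (Some c).
Proof.
pose A := [set u | b^-1 * u \in [set v | (b^-1 * a, v) \in pi]].
pose C := [set u | c^-1 * u \in [set z | (z, c^-1 * w) \in pi]].
have : 0 < #|A :&: C|.
  rewrite lt0n; apply: contraTneq m_k => AC0; rewrite -leqNgt.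
  apply: leq_trans (max_card (A :|: C)); rewrite cardsU AC0 subn0.
  by rewrite leq_add // card_translate.
case/card_gt0P => u; rewrite !inE => /andP[uA uC].
by exists u; rewrite mem_add_Some.
Qed.

Lemma Hpi_add_nonempty (x y : option gT) : exists w, w \in add x y.
Proof.
case: x y => [a|] [b|].
- by have [u uab _] := exists_intermediate_sum a b 1 1; exists (Some u).
- by exists (Some a); rewrite mem_addx0.
- by exists (Some b); rewrite mem_add0x.
- by exists None; rewrite mem_addx0.
Qed.

(** The reverse inclusion is an instance of this one, as the addition is
    commutative. *)
Lemma Hpi_add_assoc_sub (x y z u w : option gT) :
  u \in add x y -> w \in add u z ->
  exists2 v, v \in add y z & w \in add x v.
Proof.
case: x => [a|]; last first.
  by rewrite mem_add0x => /eqP-> wyz; exists w; rewrite ?mem_add0x.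
case: y => [b|]; last first.
  by rewrite mem_addx0 => /eqP-> waz; exists z; rewrite ?mem_add0x.
case: z => [c|]; last first.
  by rewrite mem_addx0 => + /eqP->; exists (Some b); rewrite ?mem_addx0.
case: w => [w|] uab.
  have [v vcb wva] := exists_intermediate_sum c b a w.
  by exists (Some v); rewrite Hpi_addC.
(* Here [c = -u], and two reversals turn [u \in a + b] into [-a \in b - u]. *)
rewrite mem_add_eq0 => /eqP->; exists (Hpi_opp (Some a)).
  by do 2!apply: Hpi_add_reversible.
by rewrite mem_add_eq0.
Qed.

Lemma Hpi_is_hyperfield : is_hyperfield (fun x y => [set` add x y]%classic) mul.
Proof.
exists None, (Some 1), Hpi_opp; split.
- by move=> x y; have [w wxy] := Hpi_add_nonempty x y; exists w.
- by move=> x y; rewrite Hpi_addC.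
- move=> x y z; apply/seteqP; split=> w [u uxy wuz].
    by have [v vyz wxv] := Hpi_add_assoc_sub uxy wuz; exists v.
  move: uxy wuz => /=; rewrite Hpi_addC (Hpi_addC x) => uzy wux.
  have [v vyx wzv] := Hpi_add_assoc_sub uzy wux.
  by exists v => /=; rewrite Hpi_addC.
- split=> [h|z zP].
    by apply/seteqP; split=> [w /set1P|w wh] //; apply/set1P.
  have : [set` add z None]%classic z by rewrite /= mem_addx0.
  by rewrite zP.
- move=> x; split=> [|y] /=; first by rewrite mem_add_eq0.
  by rewrite mem_add_eq0 => /eqP.
- by move=> x y z /= /Hpi_add_reversible.
- exact: Hpi_mulC.
- by case=> [a|] [b|] [c|] //; rewrite /Hpi_mul mulgA.
- by case=> [a|] //; rewrite /Hpi_mul mul1g.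
- move=> x y z; rewrite -(Hpi_distr x (Hpi_add_nonempty y z)).
  apply/seteqP; split=> [_ [w wyz <-]|w /imsetP[v vyz ->]] /=.
    exact: imset_f.
  by exists v.
- by case.
- by [].
- by case=> [a|] // [b|].
- by case=> [a|] // _; exists (Some a^-1); rewrite // /Hpi_mul mulgV.
Qed.

End ClosedRelation.

Theorem theorem3p7 (gT : finGroupType) (e : gT) (pi : {set gT * gT}) (m k : nat)
    (abelG : abelian [set: gT])
    (order_e : #[e]%g = 1 \/ #[e]%g = 2)
    (pi_blocks : union_of_blocks e pi)
    (m_largest : largest (fun n => forall w : gT,
       n <= #|Hpi_add e pi (Some w) (Some 1%g) :\ None|) m)
    (k_largest : largest (fun n => forall w : gT,
       n <= #|[set u : gT | Some w \in Hpi_add e pi (Some u) (Some 1%g)]|) k)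
    (m_k : #|gT| < m + k) :
  is_hyperfield (fun x y => [set` Hpi_add e pi x y]%classic) (@Hpi_mul gT).
Proof.
have ee1 : (e * e = 1)%g.
  by have := expg_order e; case: order_e => ->; rewrite ?expg2 // expg1 => ->;
     rewrite mulg1.
have [pi_cons pi_rev] := union_of_blocks_closed pi_blocks.
apply: (Hpi_is_hyperfield abelG ee1 pi_cons pi_rev _ _ m_k) => w.
  by rewrite -(add_Some1_nonzero e); apply: m_largest.1.
by rewrite -(add_Some1_summands e); apply: k_largest.1.
Qed.
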